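(* Let $x_1,x_2,x_3,x_4\in\mathbb{R}^3$ be the vertices of an upright tetrahedron, i.e. a tetrahedron such that all edges from the vertex $x_4$ have equal lengths: $r_{14}=r_{24}=r_{34}$. Then the Atiyah determinant $\det M_4$ of $(x_1,x_2,x_3,x_4)$ satisfies $$\mathrm{Re}(\det M_4)\;\geq\; 64\,r_{12}\,r_{13}\,r_{23}\,r_{14}\,r_{24}\,r_{34}.$$
   Context: For distinct points $x_1,\dots,x_4\in\mathbb{R}^3$ let $r_{ij}=|x_i-x_j|$ and $v_{ij}=(x_j-x_i)/|x_j-x_i|$ for $i\neq j$. Atiyah determinant: for $(a,b)\in\mathbb{C}^2$ with $|a|^2+|b|^2=1$ associate the unit vector $(2\,\mathrm{Re}(a\bar b),\,2\,\mathrm{Im}(a\bar b),\,|a|^2-|b|^2)\in S^2$ (this realizes $\mathbb{CP}^1\cong S^2$ by stereographic projection, the point of the Riemann sphere being $t=a/b$). For $i<j$ choose a unit vector $(a_{ij},b_{ij})\in\mathbb{C}^2$ associated with $v_{ij}$ and put $(a_{ji},b_{ji})=(-\overline{b_{ij}},\,\overline{a_{ij}})$, which is associated with $v_{ji}=-v_{ij}$. For $1\le i\le 4$ let $$p_i(t)=\prod_{j\neq i}(b_{ij}t-a_{ij})=\sum_{m=1}^{4}d_{im}t^{m-1},$$ a polynomial with roots $t_{ij}=a_{ij}/b_{ij}$ (a root at $\infty$ if $b_{ij}=0$). The Atiyah determinant is $$\det M_4=\Big(\prod_{1\le i<j\le 4}2r_{ij}\Big)\det(d_{im})_{1\le i,m\le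 4},$$ which does not depend on the choices of the $(a_{ij},b_{ij})$. *)

(* Defs.v *)
From mathcomp Require Import all_boot all_order all_algebra.
From mathcomp Require Export reals.
From mathcomp Require Export complex.

Set Implicit Arguments.
Unset Strict Implicit.
Unset Printing Implicit Defensive.

Import Order.TTheory GRing.Theory Num.Theory.
Local Open Scope ring_scope.

Section AtiyahDeterminant.
Variable R : realType.

(* The library norm on matrices is the sup norm, hence this definition. *)
Definition enorm (u : 'rV[R]_3) : R := Num.sqrt (\sum_k u 0 k ^+ 2).

(* The unit vector of R^3 associated with a unit vector (a, b) of C^2; it is
   the point a / b of the Riemann sphere under stereographic projection. *)
Definition hopf (a b : R[i]) : 'rV[R]_3 :=
  \row_(k < 3) [:: 2 * complex.Re (a * b^*%C);
                   2 * complex.Im (a * b^*%C);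
                   complex.Re (`|a| ^+ 2 - `|b| ^+ 2)]`_k.

(* The points are indexed from 0: [x 0, x 1, x 2, x 3] are the points
   x_1, x_2, x_3, x_4 of the usual notation. *)
Variable x : 'I_4 -> 'rV[R]_3.

Definition dist (i j : 'I_4) : R := enorm (x i - x j).

Definition direction (i j : 'I_4) : 'rV[R]_3 :=
  (enorm (x j - x i))^-1 *: (x j - x i).

(* [a i j] and [b i j] form an admissible choice of homogeneous coordinates
   for the directions; the diagonal values are irrelevant. *)
Definition direction_lift (a b : 'I_4 -> 'I_4 -> R[i]) : Prop :=
  forall i j : 'I_4, (i < j)%N ->
    [/\ `|a i j| ^+ 2 + `|b i j| ^+ 2 = 1,
        hopf (a i j) (b i j) = direction i j,
        a j i = - (b i j)^*%C
      & b j i = (a i j)^*%C].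

Definition atiyah_poly (a b : 'I_4 -> 'I_4 -> R[i]) (i : 'I_4) : {poly R[i]} :=
  \prod_(j < 4 | j != i) ((b i j)%:P * 'X - (a i j)%:P).

(* The coefficient of 'X^m, for m from 0 to 3, is the entry d_(i, m + 1) of the
   usual 1-based notation. *)
Definition atiyah_det (a b : 'I_4 -> 'I_4 -> R[i]) : R[i] :=
  (\prod_(i < 4) \prod_(j < 4 | (i < j)%N) (2 * dist i j))%:C%C
  * \det (\matrix_(i < 4, m < 4) (atiyah_poly a b i)`_m).

End AtiyahDeterminant.

(* Main.v *)
Require Import Defs.
From mathcomp Require Import all_boot all_order all_algebra.
From mathcomp Require Import ring lra.

Set Implicit Arguments.
Unset Strict Implicit.
Unset Printing Implicit Defensive.

Import Order.TTheory GRing.Theory Num.Theory.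
Local Open Scope ring_scope.

(** The proof has two parts: the formula of Eastwood and Norbury for the real
    part of the Atiyah determinant of four distinct points, and an elementary
    inequality between the edge lengths of an upright tetrahedron.

    The formula reads
      Re (det M) = 64 (product of the six lengths)
                   - 4 d3 (r12 r34) (r13 r24) (r14 r23)
                   + (one term for each face) + 288 V^2,
    with d3 a b c = (b + c - a) (a + c - b) (a + b - c) and V the volume. To
    obtain it, the determinant of the coefficients of the four cubics is replaced
    by the determinant of their values at 0, 1, 2, 3, which is 12 times larger
    ([det_eval]). Each of its 24 products contains, for every edge, one linear
    factor from each end point, and the spinor of the edge enters only through
    the product of these two factors. Multiplied by twice the length, this product
    is a polynomial in the length and the coordinates of the edge ([hopf_edge]).
    This removes the spinors ([atiyah_det_alt4]); adding the complex conjugate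
    gives a polynomial identity modulo the expressions of the squared lengths in
    the coordinates ([en_identity], [Re_atiyah_det]).

    If the three edges at the last vertex have length r and the opposite face has
    sides a, b, c, the term of that face and the term -4 d3 combine to
    r d3(a, b, c) (8 r^2 - a^2 - b^2 - c^2), while the other face terms and the
    volume term are nonnegative. The combined term is negative only if
    a^2 + b^2 + c^2 > 8 r^2. However the sum of squares never exceeds 9 r^2
    ([sum_sqr_dist_le]), and this leaves so little room that the other face terms
    outweigh the loss ([sum_excess], [upright_remainder_ge0]). *)

(** * Determinants of cubics as alternating sums *)

(** The signed sums over all orderings of the arguments, in the recursive form
    given by expansion along the first row of a determinant. *)
Definition alt2 (K : comNzRingType) T (g : T -> T -> K) p q := g p q - g q p.

Definition alt3 (K : comNzRingType) T (g : T -> T -> T -> K) p q r :=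
  alt2 (g p) q r - alt2 (g q) p r + alt2 (g r) p q.

Definition alt4 (K : comNzRingType) T (g : T -> T -> T -> T -> K) p q r s :=
  alt3 (g p) q r s - alt3 (g q) p r s + alt3 (g r) p q s - alt3 (g s) p q r.

Lemma alt4_ext (K : comNzRingType) T (g h : T -> T -> T -> T -> K) p q r s :
  (forall p q r s, g p q r s = h p q r s) -> alt4 g p q r s = alt4 h p q r s.
Proof. by move=> gh; rewrite /alt4 /alt3 /alt2 !gh. Qed.

Lemma alt4Z (K : comNzRingType) T c (g : T -> T -> T -> T -> K) p q r s :
  c * alt4 g p q r s = alt4 (fun p q r s => c * g p q r s) p q r s.
Proof. by rewrite /alt4 /alt3 /alt2; ring. Qed.

(** Entries indexed by natural numbers: the indices produced by a row expansion
    and the numerals of the ordinal type have the same value without being the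
    same term, and such entries depend on the value only. *)
Lemma matrix_of_nat (K : comNzRingType) n (A : 'M[K]_n.+1) :
  exists B : nat -> nat -> K, A = \matrix_(i, j) B i j.
Proof.
exists (fun i j => A (inord i) (inord j)).
by apply/matrixP => i j; rewrite mxE !inord_val.
Qed.

Lemma det_alt2 (K : comNzRingType) (A : 'M[K]_2) :
  \det A = alt2 (fun p q => A 0 p * A 1 q) 0 1.
Proof.
have [B ->] := matrix_of_nat A.
rewrite (expand_det_row _ 0) !big_ord_recl big_ord0 /cofactor !det_mx11.
rewrite /alt2 !mxE /=.
ring.
Qed.

Lemma det_alt3 (K : comNzRingType) (A : 'M[K]_3) :
  \det A = alt3 (fun p q r => A 0 p * A 1 q * A 2 r) 0 1 2.
Proof.
have [B ->] := matrix_of_nat A.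
rewrite (expand_det_row _ 0) !big_ord_recl big_ord0 /cofactor !det_alt2 !mxE /=.
rewrite /alt3 /alt2 !mxE /=.
ring.
Qed.

Lemma det_alt4 (K : comNzRingType) (A : 'M[K]_4) :
  \det A = alt4 (fun p q r s => A 0 p * A 1 q * A 2 r * A 3 s) 0 1 2 3.
Proof.
have [B ->] := matrix_of_nat A.
rewrite (expand_det_row _ 0) !big_ord_recl big_ord0 /cofactor !det_alt3 !mxE.
rewrite /alt4 /alt3 /alt2 !mxE /=.
ring.
Qed.

(** Evaluating four cubics at four points multiplies their coefficient matrix by
    a Vandermonde matrix. At 0, 1, 2, 3 its determinant is 12. *)
Lemma det_eval (K : comNzRingType) (p : 'I_4 -> {poly K}) :
  (forall i, size (p i) <= 4)%N ->
  12 * \det (\matrix_(i < 4, m < 4) (p i)`_m)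
  = alt4 (fun t0 t1 t2 t3 => (p 0).[t0] * (p 1).[t1] * (p 2).[t2] * (p 3).[t3])
      0 1 2 3.
Proof.
move=> sz_p; pose tau : 'rV[K]_4 := \row_k k%:R.
have <- : \det (Vandermonde 4 tau) = 12.
  rewrite det_Vandermonde.
  under eq_bigr => i _ do rewrite big_mkcond !big_ord_recl big_ord0 /= !mxE /=.
  rewrite !big_ord_recl big_ord0 /= /bump /=; ring.
rewrite mulrC -det_mulmx det_alt4.
have E i k : (\matrix_(i < 4, m < 4) (p i)`_m *m Vandermonde 4 tau) i k = (p i).[k%:R].
  rewrite mxE (horner_coef_wide _ (sz_p i)); apply: eq_bigr => m _.
  by rewrite !mxE.
by rewrite /alt4 /alt3 /alt2 !E.
Qed.

(** * Regrouping by pairs of vertices *)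

Lemma prod_offdiag (K : comNzRingType) n (F : 'I_n -> 'I_n -> K) :
  \prod_(i < n) \prod_(j < n | j != i) F i j
  = \prod_(i < n) \prod_(j < n | (i < j)%N) (F i j * F j i).
Proof.
under [RHS]eq_bigr do rewrite big_split /=.
rewrite [RHS]big_split /= [X in _ * X](exchange_big_dep xpredT) //= -big_split /=.
apply: eq_bigr => i _; rewrite (bigID (fun j : 'I_n => (i < j)%N)) /=.
by congr (_ * _); apply: eq_bigl => j; rewrite -val_eqE /= ; case: ltngtP.
Qed.

Lemma prod_ord4 (K : comNzRingType) (F : 'I_4 -> K) :
  \prod_i F i = F 0 * F 1 * F 2 * F 3.
Proof.
rewrite !big_ord_recl big_ord0 mulr1 !mulrA.
by congr (F _ * F _ * F _ * F _); apply: val_inj.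
Qed.

Lemma prod_pairs4 (K : comNzRingType) (F : 'I_4 -> 'I_4 -> K) :
  \prod_(i < 4) \prod_(j < 4 | (i < j)%N) F i j
  = F 0 1 * F 0 2 * F 0 3 * F 1 2 * F 1 3 * F 2 3.
Proof.
under eq_bigr do rewrite big_mkcond !big_ord_recl big_ord0.
rewrite !big_ord_recl big_ord0 /= /bump /= ?mul1r ?mulr1 !mulrA.
by congr (F _ _ * F _ _ * F _ _ * F _ _ * F _ _ * F _ _); apply: val_inj.
Qed.

(** * The Eastwood-Norbury identity *)

Section Identity.
Variable K : comNzRingType.

(** For an edge of length [l] and direction vector (X, Y, z) with [u = X + iY]
    and [w = X - iY], and a spinor (a, b) of norm 1 associated with the edge,
    this is 2 l (b s - a) (conj(a) t + conj(b)): the product of the two linear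
    factors that the edge contributes to the cubics of its end points. Unlike
    the factors, it is a polynomial in the length and the coordinates. *)
Definition edge_form (l u w z s t : K) := w * s * t + (l - z) * s - (l + z) * t - u.

(** The product of the values at [t0], ..., [t3] of the four cubics, scaled by
    the product of the doubled lengths of the edges. *)
Definition tetra_form (l : 'I_4 -> 'I_4 -> K) (u w z : 'I_4 -> K) (t0 t1 t2 t3 : K) :=
  let h i j := edge_form (l i j) (u j - u i) (w j - w i) (z j - z i) in
  h 0 1 t0 t1 * h 0 2 t0 t2 * h 0 3 t0 t3 * h 1 2 t1 t2 * h 1 3 t1 t3 * h 2 3 t2 t3.

(** For the sides of a triangle, 16 times the squared area divided by the
    perimeter (Heron). *)
Definition d3 (a b c : K) : K := (b + c - a) * (a + c - b) * (a + b - c).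

(** The triple product of the edges from the last vertex. In Cartesian
    coordinates its square is 36 times the squared volume. *)
Definition triple (u w z : 'I_4 -> K) : K :=
  (u 0 - u 3) * ((w 1 - w 3) * (z 2 - z 3) - (w 2 - w 3) * (z 1 - z 3))
  - (w 0 - w 3) * ((u 1 - u 3) * (z 2 - z 3) - (u 2 - u 3) * (z 1 - z 3))
  + (z 0 - z 3) * ((u 1 - u 3) * (w 2 - w 3) - (u 2 - u 3) * (w 1 - w 3)).

(** The contribution of the face [i], [j], [k] opposite to the vertex [m]. *)
Definition en_term (l : 'I_4 -> 'I_4 -> K) (i j k m : 'I_4) : K :=
  (l m i * ((l m j + l m k) ^+ 2 - l j k ^+ 2)
   + l m j * ((l m i + l m k) ^+ 2 - l i k ^+ 2)
   + l m k * ((l m i + l m j) ^+ 2 - l i j ^+ 2)) * d3 (l i j) (l j k) (l i k).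

(** The part of the Eastwood-Norbury formula that depends on the lengths only;
    the remaining term is 288 times the squared volume. *)
Definition en (l : 'I_4 -> 'I_4 -> K) :=
  64 * (l 0 1 * l 0 2 * l 0 3 * l 1 2 * l 1 3 * l 2 3)
  - 4 * d3 (l 0 1 * l 2 3) (l 0 2 * l 1 3) (l 0 3 * l 1 2)
  + (en_term l 1 2 3 0 + en_term l 0 2 3 1 + en_term l 0 1 3 2 + en_term l 0 1 2 3).

(** Exchanging [u] and [w] is complex conjugation, so the left-hand side is twice
    the real part of 12 times the Atiyah determinant. It is invariant under
    rotations and reflections, hence a polynomial in the lengths and the scalar
    products of the edges; the latter are combinations of squared lengths. The
    squared triple product is such a polynomial too; it is kept as a square
    because this shows its sign in Cartesian coordinates. *)
Lemma en_identity l u w z :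
  (forall i j, l i j = l j i) ->
  (forall i j, l i j ^+ 2 = (u j - u i) * (w j - w i) + (z j - z i) ^+ 2) ->
  alt4 (tetra_form l u w z) 0 1 2 3 + alt4 (tetra_form l w u z) 0 1 2 3
  = 12 * (2 * en l - 4 * triple u w z ^+ 2).
Proof.
move=> lC l2.
rewrite /en /en_term (lC 1 0) (lC 2 0) (lC 2 1) (lC 3 0) (lC 3 1) (lC 3 2).
rewrite /alt4 /alt3 /alt2 /tetra_form /edge_form /d3 /triple.
ring: (l2 0 1) (l2 0 2) (l2 0 3) (l2 1 2) (l2 1 3) (l2 2 3).
Qed.

End Identity.

(** * Compatibility with ring morphisms *)

Lemma rmorph_tetra (K L : comNzRingType) (f : {rmorphism K -> L}) l u w z p q r s :
  f (tetra_form l u w z p q r s) =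
  tetra_form (fun i j => f (l i j)) (fun i => f (u i)) (fun i => f (w i))
    (fun i => f (z i)) (f p) (f q) (f r) (f s).
Proof. by rewrite /tetra_form /edge_form !(rmorphM, rmorphB, rmorphD). Qed.

Lemma rmorph_alt4 (K L : comNzRingType) (f : {rmorphism K -> L}) l u w z :
  f (alt4 (tetra_form l u w z) 0 1 2 3) =
  alt4 (tetra_form (fun i j => f (l i j)) (fun i => f (u i)) (fun i => f (w i))
    (fun i => f (z i))) 0 1 2 3.
Proof.
rewrite /alt4 /alt3 /alt2 !(rmorphB, rmorphD) !rmorph_tetra.
by rewrite rmorph0 rmorph1 !rmorph_nat.
Qed.

Lemma rmorph_d3 (K L : comNzRingType) (f : {rmorphism K -> L}) a b c :
  f (d3 a b c) = d3 (f a) (f b) (f c).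
Proof. by rewrite /d3 !(rmorphM, rmorphB, rmorphD). Qed.

Lemma rmorph_en_term (K L : comNzRingType) (f : {rmorphism K -> L}) l i j k m :
  f (en_term l i j k m) = en_term (fun i j => f (l i j)) i j k m.
Proof.
rewrite /en_term rmorphM rmorph_d3 !rmorphD.
by rewrite !rmorphM !rmorphD !rmorphN !rmorphXn !rmorphD.
Qed.

Lemma rmorph_en (K L : comNzRingType) (f : {rmorphism K -> L}) l :
  f (en l) = en (fun i j => f (l i j)).
Proof.
rewrite /en !rmorphD rmorphN !rmorph_en_term.
rewrite [f (4 * _)]rmorphM rmorph_d3 [f (64 * _)]rmorphM !rmorph_nat !rmorphM.
by [].
Qed.

Lemma rmorph_triple (K L : comNzRingType) (f : {rmorphism K -> L}) u w z :
  f (triple u w z) = triple (fun i => f (u i)) (fun i => f (w i)) (fun i => f (z i)).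
Proof.
rewrite /triple.
by rewrite !(rmorphB, rmorphD, rmorphM).
Qed.

(** * Euclidean lengths and distances *)

Section Distances.
Variable R : realType.
Implicit Types (u v : 'rV[R]_3) (x : 'I_4 -> 'rV[R]_3).

Lemma enorm_sqr u : enorm u ^+ 2 = u 0 0 ^+ 2 + u 0 1 ^+ 2 + u 0 2 ^+ 2.
Proof.
rewrite /enorm sqr_sqrtr; last by apply: sumr_ge0 => i _; apply: sqr_ge0.
rewrite !big_ord_recl big_ord0 addr0 addrA.
by congr (u 0 _ ^+ 2 + u 0 _ ^+ 2 + u 0 _ ^+ 2); apply: val_inj.
Qed.

Lemma enorm_ge0 u : 0 <= enorm u. Proof. exact: sqrtr_ge0. Qed.

Lemma enormN u : enorm (- u) = enorm u.
Proof. by congr Num.sqrt; apply: eq_bigr => k _; rewrite mxE sqrrN. Qed.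

Lemma enorm_eq0 u : (enorm u == 0) = (u == 0).
Proof.
apply/idP/idP => [|/eqP->]; last first.
  by rewrite -sqrf_eq0 enorm_sqr !mxE expr0n !addr0.
rewrite /enorm sqrtr_eq0 => s0; apply/eqP/rowP => k; rewrite mxE.
have sq_ge0 i : true -> 0 <= u 0 i ^+ 2 by move=> _; apply: sqr_ge0.
have /(psumr_eq0P sq_ge0)/(_ k isT)/eqP : \sum_k u 0 k ^+ 2 = 0.
  by apply/eqP; rewrite eq_le s0 sumr_ge0.
by rewrite sqrf_eq0 => /eqP->.
Qed.

Lemma enorm_triangle u v : enorm (u + v) <= enorm u + enorm v.
Proof.
have dot_le : u 0 0 * v 0 0 + u 0 1 * v 0 1 + u 0 2 * v 0 2 <= enorm u * enorm v.
  apply: le_trans (ler_norm _) _.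
  rewrite -ler_sqr ?nnegrE ?mulr_ge0 ?enorm_ge0 ?normr_ge0 //.
  rewrite real_normK ?num_real // exprMn !enorm_sqr -subr_ge0.
  set d := (X in 0 <= X).
  suff -> : d = (u 0 1 * v 0 2 - u 0 2 * v 0 1) ^+ 2
    + (u 0 2 * v 0 0 - u 0 0 * v 0 2) ^+ 2 + (u 0 0 * v 0 1 - u 0 1 * v 0 0) ^+ 2.
    by rewrite !addr_ge0 ?sqr_ge0.
  by rewrite /d; ring.
rewrite -ler_sqr ?nnegrE ?addr_ge0 ?enorm_ge0 //.
have := enorm_sqr (u + v); have := enorm_sqr u; have := enorm_sqr v.
by rewrite !mxE; nra.
Qed.

Lemma distC x i j : dist x i j = dist x j i.
Proof. by rewrite /dist -opprB enormN. Qed.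

Lemma dist_ge0 x i j : 0 <= dist x i j. Proof. exact: enorm_ge0. Qed.

Lemma dist_gt0 x i j : injective x -> i != j -> 0 < dist x i j.
Proof.
move=> inj_x ij; rewrite lt_def dist_ge0 andbT enorm_eq0 subr_eq0.
by rewrite (inj_eq inj_x).
Qed.

Lemma dist_triangle x i j k : dist x i k <= dist x i j + dist x j k.
Proof. by rewrite /dist -(subrKA (x j) (x i)) enorm_triangle. Qed.

(** The difference of the two sides is the squared length of the sum of the edges
    from the last vertex (Leibniz). If that vertex has the same distance [r] to
    the others, the bound on the sum of the squared sides is 9 r^2. *)
Lemma sum_sqr_dist_le x :
  dist x 0 1 ^+ 2 + dist x 0 2 ^+ 2 + dist x 1 2 ^+ 2
  <= 3 * (dist x 0 3 ^+ 2 + dist x 1 3 ^+ 2 + dist x 2 3 ^+ 2).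
Proof.
rewrite -subr_ge0; set d := (X in 0 <= X).
suff -> : d = enorm ((x 0 - x 3) + (x 1 - x 3) + (x 2 - x 3)) ^+ 2 by rewrite sqr_ge0.
by rewrite /d !enorm_sqr !mxE; ring.
Qed.

End Distances.

(** * The real part of the Atiyah determinant *)

Lemma eq_triple (K : comNzRingType) (u u' w w' z z' : 'I_4 -> K) :
  u =1 u' -> w =1 w' -> z =1 z' -> triple u w z = triple u' w' z'.
Proof. by move=> eu ew ez; rewrite /triple !eu !ew !ez. Qed.

(** Here [i] is an imaginary unit: the square of the factor is -4, which turns
    the volume term of [en_identity] into the one of [Re_atiyah_det]. *)
Lemma triple_complex (K : comNzRingType) (i : K) (u w z : 'I_4 -> K) :
  triple (fun k => u k + i * w k) (fun k => u k - i * w k) z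
  = - 2 * i * triple u w z.
Proof. by rewrite /triple; ring. Qed.

Section RealPart.
Variable R : realType.
Implicit Types (e u : 'rV[R]_3) (x : 'I_4 -> 'rV[R]_3).

Definition planar u : R[i] := (u 0 0 +i* u 0 1)%C.

(** The products of [a], [b] with their conjugates are affine in the unit vector
    (x, y, z) along [e]: 2 a conj(a) = 1 + z, 2 b conj(b) = 1 - z and 2 a conj(b) = x + iy. *)
Lemma hopf_edge e (a b s t : R[i]) : 0 < enorm e ->
  `|a| ^+ 2 + `|b| ^+ 2 = 1 -> hopf a b = (enorm e)^-1 *: e ->
  (2 * enorm e)%:C%C * ((b * s - a) * (a^*%C * t + b^*%C))
  = edge_form (enorm e)%:C%C (planar e) (planar e)^*%C (e 0 2)%:C%C s t.
Proof.
move=> e_gt0 ab1 /rowP hab.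
have e0 := hab 0; have e1 := hab 1; have e2 := hab 2.
move: e_gt0 ab1 e0 e1 e2; rewrite !mxE !sqr_normc /= /planar.
move: (enorm e) (e 0 0) (e 0 1) (e 0 2) => r x y z r_gt0 {hab}.
case: a b => [a1 a2] [b1 b2] /= [norm1 _].
have rK v w : v = r^-1 * w -> r * v = w by move=> ->; rewrite mulVKf ?gt_eqF.
have /(congr1 ( *%R r)) := norm1; rewrite mulr1 => norm_r.
move=> /rK e0 /rK e1 /rK e2.
pose a := (a1 +i* a2)%C; pose b := (b1 +i* b2)%C.
have aa : (2 * r)%:C%C * (a * a^*%C) = r%:C%C + z%:C%C.
  by apply/eqP; rewrite eq_complex /=; apply/andP; split; apply/eqP; lra.
have bb : (2 * r)%:C%C * (b * b^*%C) = r%:C%C - z%:C%C.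
  by apply/eqP; rewrite eq_complex /=; apply/andP; split; apply/eqP; lra.
have ab : (2 * r)%:C%C * (a * b^*%C) = (x +i* y)%C.
  by apply/eqP; rewrite eq_complex /=; apply/andP; split; apply/eqP; lra.
have ba : (2 * r)%:C%C * (b * a^*%C) = (x -i* y)%C.
  by apply/eqP; rewrite eq_complex /=; apply/andP; split; apply/eqP; lra.
rewrite -/a -/b -[(a1 -i* a2)%C]/(a^*%C) -[(b1 -i* b2)%C]/(b^*%C).
rewrite /edge_form -ab -ba -aa -bb.
move: (a^*)%C (b^*)%C (2 * r)%:C%C => a' b' n; ring.
Qed.

Lemma horner_atiyah_poly (a b : 'I_4 -> 'I_4 -> R[i]) i t :
  (atiyah_poly a b i).[t] = \prod_(j < 4 | j != i) (b i j * t - a i j).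
Proof. by rewrite horner_prod; apply: eq_bigr => j _; rewrite !hornerE. Qed.

Lemma size_atiyah_poly (a b : 'I_4 -> 'I_4 -> R[i]) i :
  (size (atiyah_poly a b i) <= 4)%N.
Proof.
apply: leq_trans (size_poly_prod_leq _ _) _; rewrite leq_subLR.
rewrite cardC1 card_ord /=.
apply: (@leq_ltn_trans (\sum_(j < 4 | j != i) 2)).
  apply: leq_sum => j _.
  apply: leq_trans (size_polyD _ _) _; rewrite geq_max size_polyN.
  rewrite (leq_trans (size_polyC_leq1 _) _) // andbT.
  apply: leq_trans (size_polyMleq _ _) _.
  by rewrite size_polyX addn2 /= ltnS size_polyC_leq1.
by rewrite sum_nat_const cardC1 card_ord.
Qed.

(** Each permutation term of the determinant of values is a product over ordered
    pairs of distinct vertices; grouping the pairs (i, j) and (j, i) leaves one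
    edge form for each edge, and the spinors disappear. *)
Lemma atiyah_det_alt4 x a b : injective x -> direction_lift x a b ->
  12 * atiyah_det x a b =
  alt4 (tetra_form (fun i j => (dist x i j)%:C%C) (fun i => planar (x i))
     (fun i => (planar (x i))^*%C) (fun i => (x i 0 2)%:C%C)) 0 1 2 3.
Proof.
move=> inj_x lift_ab; rewrite /atiyah_det mulrCA (det_eval (size_atiyah_poly a b)).
rewrite alt4Z; apply: alt4_ext => p q r s.
pose t (i : 'I_4) := [:: p; q; r; s]`_i.
have -> : (atiyah_poly a b 0).[p] * (atiyah_poly a b 1).[q] * (atiyah_poly a b 2).[r]
  * (atiyah_poly a b 3).[s] = \prod_(i < 4) \prod_(j < 4 | j != i) (b i j * t i - a i j).
  by rewrite prod_ord4 !horner_atiyah_poly.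
rewrite prod_offdiag rmorph_prod -big_split /=.
transitivity (\prod_(i < 4) \prod_(j < 4 | (i < j)%N)
   edge_form (dist x i j)%:C%C (planar (x j) - planar (x i))
    ((planar (x j))^*%C - (planar (x i))^*%C)
    ((x j 0 2)%:C%C - (x i 0 2)%:C%C) (t i) (t j)); last first.
  by rewrite prod_pairs4.
apply: eq_bigr => i _; rewrite rmorph_prod -big_split /=.
apply: eq_bigr => j lt_ij.
have [norm_ab hopf_ab -> ->] := lift_ab i j lt_ij.
have d_gt0 : 0 < enorm (x j - x i).
  by have := dist_gt0 inj_x (_ : j != i); apply; rewrite -val_eqE gtn_eqF.
have := hopf_edge (t i) (t j) d_gt0 norm_ab hopf_ab.
rewrite distC -/(dist x j i) opprK => ->; rewrite /planar !mxE /=.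
by congr (edge_form _ _ _ _ _); rewrite ?rmorphB ?opprD //.
Qed.

(** The Eastwood-Norbury formula, for any four distinct points. *)
Lemma Re_atiyah_det x a b : injective x -> direction_lift x a b ->
  complex.Re (atiyah_det x a b) = en (dist x)
    + 8 * triple (fun i => x i 0 0) (fun i => x i 0 1) (fun i => x i 0 2) ^+ 2.
Proof.
move=> inj_x lift_ab; have D := atiyah_det_alt4 inj_x lift_ab.
have Dc : 12 * (atiyah_det x a b)^*%C =
  alt4 (tetra_form (fun i j => (dist x i j)%:C%C) (fun i => (planar (x i))^*%C)
    (fun i => planar (x i)) (fun i => (x i 0 2)%:C%C)) 0 1 2 3.
  (* Conjugation fixes the evaluation points 0, 1, 2, 3. *)
  rewrite -(rmorph_nat (@conjc R)) -rmorphM D rmorph_alt4.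
  apply: alt4_ext => p q r s; rewrite /tetra_form /=.
  by rewrite !oppr0 !opprK.
set t := triple _ _ _.
have tC : triple (fun i => planar (x i)) (fun i => (planar (x i))^*%C)
    (fun i => (x i 0 2)%:C%C) = - 2 * 'i%C * t%:C%C.
  rewrite rmorph_triple -triple_complex.
  apply: eq_triple => k; first exact: complexE.
    by apply/eqP; rewrite eq_complex /=; apply/andP; split; apply/eqP; ring.
  by [].
have dC i j : (dist x i j)%:C%C ^+ 2 = (planar (x j) - planar (x i))
    * ((planar (x j))^*%C - (planar (x i))^*%C) + ((x j 0 2)%:C%C - (x i 0 2)%:C%C) ^+ 2.
  rewrite -rmorphXn distC enorm_sqr !mxE /planar.
  by apply/eqP; rewrite eq_complex /=; apply/andP; split; apply/eqP; ring.
have dist_sym i j : (dist x i j)%:C%C = (dist x j i)%:C%C :> R[i] by rewrite distC.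
have := en_identity dist_sym dC.
rewrite -D -Dc -mulrDr tC -rmorph_en.
rewrite addcJ => /mulfI; rewrite pnatr_eq0 => /(_ isT).
have tr : (en (dist x) + 8 * t ^+ 2)%:C%C = (en (dist x))%:C%C + 8 * t%:C%C ^+ 2.
  by rewrite rmorphD rmorphM rmorphXn rmorph_nat.
have -> : 2 * (en (dist x))%:C%C - 4 * (- 2 * 'i%C * t%:C%C) ^+ 2
    = 2 * (en (dist x) + 8 * t ^+ 2)%:C%C.
  by rewrite tr; ring: (@sqr_i R).
by move=> /mulfI; rewrite pnatr_eq0 => /(_ isT) /complexI.
Qed.

End RealPart.

(** * The inequality for upright tetrahedra *)

Section Upright.
Variable R : realFieldType.
Implicit Types a b c r : R.

(** The upper bound is 8 p q s <= (p + q) (q + s) (s + p) for the factors [p],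
    [q], [s] of [d3], whose pairwise sums are the doubled sides. *)
Lemma d3_bounds a b c : 0 <= a -> 0 <= b -> 0 <= c ->
  a <= b + c -> b <= a + c -> c <= a + b -> 0 <= d3 a b c <= a * b * c.
Proof.
move=> a0 b0 c0 abc bac cab.
pose p := b + c - a; pose q := a + c - b; pose s := a + b - c.
have p0 : 0 <= p by rewrite /p; lra.
have q0 : 0 <= q by rewrite /q; lra.
have s0 : 0 <= s by rewrite /s; lra.
rewrite /d3 -/p -/q -/s !mulr_ge0 //=.
have -> : a = (q + s) / 2 by rewrite /q /s; field.
have -> : b = (p + s) / 2 by rewrite /p /s; field.
have -> : c = (p + q) / 2 by rewrite /p /q; field.
have := mulr_ge0 p0 (sqr_ge0 (q - s)).
have := mulr_ge0 q0 (sqr_ge0 (p - s)).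
have := mulr_ge0 s0 (sqr_ge0 (p - q)).
lra.
Qed.

(** The left-hand side is at most c^2, because the other two sides are at most
    2 r, and at most r^2. Since 3 c^2 <= 9 r^2 implies c <= 7/4 r, one of the two
    bounds is sufficient: c^2 if c <= 8/5 r, and r^2 otherwise. *)
Lemma shortest_side_bound a b c r :
  0 <= c -> c <= a -> c <= b -> a <= 2 * r -> b <= 2 * r ->
  a ^+ 2 + b ^+ 2 + c ^+ 2 <= 9 * r ^+ 2 ->
  a ^+ 2 + b ^+ 2 + c ^+ 2 - 8 * r ^+ 2 <= 4 * (c * (2 * r - c)).
Proof.
move=> c0 ca cb ar br S9.
have c74 : c <= 7 / 4 * r by nra.
have [c85|c85] := leP c (8 / 5 * r).
  have : a ^+ 2 <= 4 * r ^+ 2 by nra.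
  have : b ^+ 2 <= 4 * r ^+ 2 by nra.
  nra.
nra.
Qed.

Lemma sum_excess a b c r :
  0 <= a <= 2 * r -> 0 <= b <= 2 * r -> 0 <= c <= 2 * r ->
  a ^+ 2 + b ^+ 2 + c ^+ 2 <= 9 * r ^+ 2 ->
  a ^+ 2 + b ^+ 2 + c ^+ 2 - 8 * r ^+ 2
  <= 4 * (a * (2 * r - a) + b * (2 * r - b) + c * (2 * r - c)).
Proof.
move=> /andP[a0 ar] /andP[b0 br] /andP[c0 cr] S9.
have Ta : 0 <= a * (2 * r - a) by rewrite mulr_ge0 ?subr_ge0.
have Tb : 0 <= b * (2 * r - b) by rewrite mulr_ge0 ?subr_ge0.
have Tc : 0 <= c * (2 * r - c) by rewrite mulr_ge0 ?subr_ge0.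
have [ab|/ltW ba] := leP a b; have [bc|/ltW cb] := leP b c.
- by have := shortest_side_bound a0 ab (le_trans ab bc) br cr; lra.
- have [ac|/ltW ca] := leP a c.
    by have := shortest_side_bound a0 ab ac br cr; lra.
  by have := shortest_side_bound c0 ca cb ar br; lra.
- by have := shortest_side_bound b0 ba bc ar cr; lra.
- by have := shortest_side_bound c0 (le_trans cb ba) cb ar br; lra.
Qed.

(** If the edges at the last vertex have length [r], this is what the formula
    contains besides the product of the lengths and the volume term. Only the
    first summand can be negative. There [d3 a b c] is at most [a b c],
    and the terms 4 b c r, 4 a c r, 4 a b r of the face contributions sum up to
    4 a b c r (a (2 r - a) + b (2 r - b) + c (2 r - c)), which compensates it. *)
Lemma upright_remainder_ge0 a b c r :
  0 <= a <= 2 * r -> 0 <= b <= 2 * r -> 0 <= c <= 2 * r ->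
  a <= b + c -> b <= a + c -> c <= a + b ->
  a ^+ 2 + b ^+ 2 + c ^+ 2 <= 9 * r ^+ 2 ->
  0 <= r * d3 a b c * (8 * r ^+ 2 - (a ^+ 2 + b ^+ 2 + c ^+ 2))
    + (a ^+ 2 * (2 * r - a)
         * (b * c * (b + c) + 4 * b * c * r + r * ((b + c) ^+ 2 - a ^+ 2))
       + b ^+ 2 * (2 * r - b)
         * (a * c * (a + c) + 4 * a * c * r + r * ((a + c) ^+ 2 - b ^+ 2))
       + c ^+ 2 * (2 * r - c)
         * (a * b * (a + b) + 4 * a * b * r + r * ((a + b) ^+ 2 - c ^+ 2))).
Proof.
move=> a2r b2r c2r abc bac cab S9; have exc := sum_excess a2r b2r c2r S9.
move: a2r b2r c2r => /andP[a0 ar] /andP[b0 br] /andP[c0 cr].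
have r0 : 0 <= r by lra.
have /andP[h0 habc] := d3_bounds a0 b0 c0 abc bac cab.
have face p q s : 0 <= p -> 0 <= q -> 0 <= s -> p <= q + s -> p <= 2 * r ->
    4 * (p * q * s) * r * (p * (2 * r - p))
    <= p ^+ 2 * (2 * r - p)
       * (q * s * (q + s) + 4 * q * s * r + r * ((q + s) ^+ 2 - p ^+ 2)).
  move=> p0 q0 s0 pqs pr.
  have : 0 <= p ^+ 2 * (2 * r - p) * (q * s * (q + s) + r * ((q + s) ^+ 2 - p ^+ 2)).
    have d0 : 0 <= (q + s) ^+ 2 - p ^+ 2 by rewrite subr_ge0 ler_sqr ?nnegrE ?addr_ge0.
    rewrite mulr_ge0 //; first by rewrite mulr_ge0 ?sqr_ge0 ?subr_ge0.
    by apply: addr_ge0; apply: mulr_ge0 => //; [apply: mulr_ge0|apply: addr_ge0].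
  lra.
have := face a b c a0 b0 c0 abc ar; have := face b a c b0 a0 c0 bac br.
have := face c a b c0 a0 b0 cab cr.
move: exc; set S := a ^+ 2 + b ^+ 2 + c ^+ 2.
set Ta := a * (2 * r - a); set Tb := b * (2 * r - b); set Tc := c * (2 * r - c).
move=> exc fc fb fa.
have Tge0 : 0 <= Ta + Tb + Tc by rewrite !addr_ge0 ?mulr_ge0 ?subr_ge0.
suff : 0 <= r * (d3 a b c * (8 * r ^+ 2 - S) + 4 * (a * b * c) * (Ta + Tb + Tc)) by lra.
apply: mulr_ge0 => //.
have abc0 : 0 <= a * b * c by rewrite !mulr_ge0.
have [S8|/ltW S8] := leP S (8 * r ^+ 2).
  by rewrite addr_ge0 ?mulr_ge0 ?subr_ge0.
have := ler_wpM2l abc0 exc.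
have := ler_wpM2r (_ : 0 <= S - 8 * r ^+ 2) habc; rewrite subr_ge0 => /(_ S8).
lra.
Qed.

End Upright.

Theorem mainTheorem1 (R : realType) (x : 'I_4 -> 'rV[R]_3)
    (a b : 'I_4 -> 'I_4 -> R[i]) :
  injective x ->
  direction_lift x a b ->
  dist x 0 3 = dist x 1 3 ->
  dist x 1 3 = dist x 2 3 ->
  complex.Re (atiyah_det x a b) >=
    64 * dist x 0 1 * dist x 0 2 * dist x 1 2
       * dist x 0 3 * dist x 1 3 * dist x 2 3.
Proof.
move=> inj_x lift_ab r01 r12.
rewrite (Re_atiyah_det inj_x lift_ab) /en /en_term.
rewrite !(distC x 3) (distC x 1 0) (distC x 2 0) (distC x 2 1).
have l12 := dist_triangle x 1 3 2; have l02 := dist_triangle x 0 3 2.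
have l01 := dist_triangle x 0 3 1; have t012 := dist_triangle x 0 1 2.
have t021 := dist_triangle x 0 2 1; have t102 := dist_triangle x 1 0 2.
have S9 := sum_sqr_dist_le x.
rewrite !(distC x 3) r01 r12 (distC x 2 1) (distC x 1 0) in l12 l02 l01 t012 t021 t102 S9 *.
have := dist_ge0 x 1 2; have := dist_ge0 x 0 2; have := dist_ge0 x 0 1.
move: (dist x 0 1) (dist x 0 2) (dist x 1 2) (dist x 2 3) l12 l02 l01 t012 t021 t102 S9
  => lc lb la r l12 l02 l01 t012 t021 t102 S9 c0 b0 a0.
have := @upright_remainder_ge0 _ la lb lc r.
rewrite a0 b0 c0 /= => rem_ge0.
have {rem_ge0} := rem_ge0 ltac:(lra) ltac:(lra) ltac:(lra) ltac:(lra) ltac:(lra)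
  ltac:(lra) ltac:(lra).
have := sqr_ge0 (triple (fun i => x i 0 0) (fun i => x i 0 1) (fun i => x i 0 2)).
by rewrite /d3; lra.
Qed.
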